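(* Let $X \subset \mathbb R^n$ be a regular convex set, $f$ a projectively self-concordant barrier on $X$ with parameter $\gamma = \frac{\nu-2}{\sqrt{\nu-1}}$, $\nu\ge 2$, and $x_0 \in X^o$ a point. Let $G = f'' - f'f'^T$. Then the set \[ \Gamma^p_{f,x_0} = \left\{ x \in \mathbb R^n \,\left|\, 1 - f'(x_0)[x-x_0] > \sqrt{\frac{1}{\nu-1}G(x_0)[x-x_0,x-x_0]} \right. \right\} \] is convex and contains $X^o$.
   Context: A regular convex set $X \subset \mathbb R^n$ is a closed convex set with non-empty interior $X^o$ containing no lines; $\partial X$ is its boundary. A projectively self-concordant barrier on $X$ with parameter $\gamma \geq 0$ is a $C^3$ function $f: X^o \to \mathbb R$ such that: (1) $f''(x) - f'(x)f'(x)^T \succ 0$ (positive definite) for all $x \in X^o$; (2) $\lim_{x \to\partial X} f(x) = +\infty$, i.e. $f(x_k)\to+\infty$ whenever $x_k \in X^o$ converges to a point of $\partial X$; (3) $|f'''(x)[h,h,h] - 6f''(x)[h,h]f'(x)[h] + 4(f'(x)[h])^3| \leq 2\gamma(f''(x)[h,h] - (f'(x)[h])^2)^{3/2}$ for all $x \in X^o$, $h \in \mathbb R^n$. *)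

(* Defs.v *)
From HB Require Import structures.
From mathcomp Require Import all_boot all_order all_algebra.
From mathcomp Require Import all_classical all_reals all_analysis.

Set Implicit Arguments.
Unset Strict Implicit.
Unset Printing Implicit Defensive.

Import Order.TTheory GRing.Theory Num.Theory.
Import numFieldNormedType.Exports.

Local Open Scope classical_set_scope.
Local Open Scope ring_scope.

(* Functions on the interior of X are represented by total functions on
   'rV[R]_n; only their values on the (open) interior are ever constrained. *)

Definition boundary (T : topologicalType) (X : set T) : set T :=
  closure X `\` X°.

Definition contains_no_line (R : realType) (n : nat) (X : set 'rV[R]_n) : Prop :=
  ~ exists x v : 'rV[R]_n, v != 0 /\ forall t : R, X (x + t *: v).

Definition regular_convex_set (R : realType) (n : nat) (X : set 'rV[R]_n) : Prop :=
  [/\ closed X, convex_set X, X° !=set0 & contains_no_line X].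

(* C^k regularity on a set U, meaningful for U open: f is C^(k+1) iff it is
   differentiable on U and all its directional derivatives are C^k on U. *)
Fixpoint Ck_on (R : realType) (n k : nat) (U : set 'rV[R]_n)
    (f : 'rV[R]_n -> R) : Prop :=
  if k is k'.+1 then
    (forall x, U x -> differentiable f x) /\
    (forall h : 'rV[R]_n, Ck_on k' U ('D_h f))
  else forall x, U x -> {for x, continuous f}.

(* f'(x)[h], f''(x)[h, k] and f'''(x)[h, k, l] as multilinear forms *)
Definition D1 (R : realType) (n : nat) (f : 'rV[R]_n -> R) (x h : 'rV[R]_n) : R :=
  'D_h f x.

Definition D2 (R : realType) (n : nat) (f : 'rV[R]_n -> R)
    (x h k : 'rV[R]_n) : R :=
  'D_k ('D_h f) x.

Definition D3 (R : realType) (n : nat) (f : 'rV[R]_n -> R)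
    (x h k l : 'rV[R]_n) : R :=
  'D_l ('D_k ('D_h f)) x.

(* The bilinear form of the matrix f''(x) - f'(x) f'(x)^T. *)
Definition Gform (R : realType) (n : nat) (f : 'rV[R]_n -> R)
    (x h k : 'rV[R]_n) : R :=
  D2 f x h k - D1 f x h * D1 f x k.

(* The symmetry of the forms this is applied to, Gform f x, is automatic for
   f of class C^2 near x. *)
Definition posdef_form (R : realType) (n : nat)
    (B : 'rV[R]_n -> 'rV[R]_n -> R) : Prop :=
  forall h : 'rV[R]_n, h != 0 -> 0 < B h h.

Record proj_self_concordant_barrier (R : realType) (n : nat)
    (X : set 'rV[R]_n) (gamma : R) (f : 'rV[R]_n -> R) : Prop := {
  pscb_param_ge0 : 0 <= gamma;
  pscb_C3 : Ck_on 3 X° f;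
  pscb_posdef : forall x, X° x -> posdef_form (Gform f x);
  pscb_barrier : forall (u : nat -> 'rV[R]_n) (a : 'rV[R]_n),
    (forall k, X° (u k)) -> boundary X a -> u k @[k --> \oo] --> a ->
    f (u k) @[k --> \oo] --> +oo;
  pscb_concordance : forall x h, X° x ->
    `|D3 f x h h h - 6 * D2 f x h h * D1 f x h + 4 * D1 f x h ^+ 3|
      <= 2 * gamma * (D2 f x h h - D1 f x h ^+ 2) `^ (3 / 2)
}.

Definition Gamma_p (R : realType) (n : nat) (nu : R) (f : 'rV[R]_n -> R)
    (x0 : 'rV[R]_n) : set 'rV[R]_n :=
  [set x | 1 - D1 f x0 (x - x0)
           > Num.sqrt (1 / (nu - 1) * Gform f x0 (x - x0) (x - x0))].

(* Main.v *)
(** Put h = x - x0 and restrict f to the segment from x0 to x.  With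
    p = f'[h], s = sqrt (f''[h,h] - p^2) and c = 1 / sqrt (nu - 1), one has
    p' = s^2 + p^2, while the concordance inequality reads
    |s' - 2 p s| <= gamma s^2 with gamma = 1/c - c.  Hence w = p + c s satisfies
    w' >= (1 - c gamma) s^2 + p^2 + 2 c p s = w^2.
    A solution of w' >= w^2 with w 0 >= 1 blows up before time 1, so w 0 < 1,
    which says exactly that x lies in the set.  The set is convex because
    the square root of a positive definite quadratic form is a seminorm. *)
Require Import Defs.
From HB Require Import structures.
From mathcomp Require Import all_boot all_order all_algebra.
From mathcomp Require Import all_classical all_reals all_analysis.
From mathcomp Require Import ring lra.

Set Implicit Arguments.
Unset Strict Implicit.
Unset Printing Implicit Defensive.

Import Order.TTheory GRing.Theory Num.Theory.
Import numFieldNormedType.Exports.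

Local Open Scope classical_set_scope.
Local Open Scope ring_scope.

(** * Convex combinations and linear forms *)

Lemma convex_setP (R : realType) (V : lmodType R) (A : set V) :
  convex_set A <->
  forall (x y : V) (a : R), 0 <= a -> a <= 1 -> A x -> A y ->
    A (a *: x + (1 - a) *: y).
Proof.
split => [cA x y a a0 a1 Ax Ay|cA x y a].
  by have := cA x y (Itv01 a0 a1); rewrite !inE; exact.
by rewrite !inE; apply: cA.
Qed.

(** Displacing a convex combination by [e] amounts to displacing both endpoints by the same [e], so
    a common small range of [e] serves. *)
Lemma convex_interior (R : realType) (V : normedModType R) (A : set V) :
  convex_set A -> convex_set A°.
Proof.
move=> /convex_setP cA; apply/convex_setP => x y a a0 a1.
move=> /nbhs0P Ax /nbhs0P Ay; apply/nbhs0P; near=> e.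
have -> : a *: x + (1 - a) *: y + e = a *: (x + e) + (1 - a) *: (y + e).
  by rewrite !scalerDr addrACA -scalerDl subrKC scale1r.
by apply: cA => //; near: e.
Unshelve. all: by end_near. Qed.

Lemma scalar0 (R : realType) (V : lmodType R) (l : V -> R) :
  scalar l -> l 0 = 0.
Proof. by move=> /(_ (-1) 0 0); rewrite scaler0 addr0 /=; lra. Qed.

Lemma scalar_comb (R : realType) (V : lmodType R) (l : V -> R) :
  scalar l -> forall a b u v, l (a *: u + b *: v) = a * l u + b * l v.
Proof.
move=> ls a b u v; rewrite ls; congr (_ + _).
by rewrite -[b *: v]addr0 ls (scalar0 ls) addr0.
Qed.

(** * Positive definite bilinear forms and their seminorms *)

Section Forms.
Variables (R : realType) (V : lmodType R) (B : V -> V -> R).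
Hypothesis Bl : forall k, scalar (B^~ k).
Hypothesis Br : forall h, scalar (B h).
Hypothesis Bpos : forall h, h != 0 -> 0 < B h h.

Let B_ge0 h : 0 <= B h h.
Proof.
by have [->|/Bpos/ltW//] := eqVneq h 0; rewrite (scalar0 (Br 0)).
Qed.

Let B_comb (a b : R) u v :
  B (a *: u + b *: v) (a *: u + b *: v) =
  a ^+ 2 * B u u + a * b * (B u v + B v u) + b ^+ 2 * B v v.
Proof.
by rewrite (scalar_comb (Bl _)) !(scalar_comb (Br _)); ring.
Qed.

(* Stated for the symmetrised form, which avoids Schwarz's theorem on the
   symmetry of second derivatives. *)
Lemma form_cauchy_schwarz u v :
  (B u v + B v u) ^+ 2 <= 4 * B u u * B v v.
Proof.
have [->|v0] := eqVneq v 0.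
  have /= -> := scalar0 (Bl u).
  by rewrite (scalar0 (Br u)) addr0 expr0n /= !mulr_ge0.
(* This vector is a multiple of [u - t v] at the [t] minimising the form; its value factors as
   [c * (4 * d * c - m ^+ 2)]. *)
have := B_ge0 ((2 * B v v) *: u + (- (B u v + B v u)) *: v).
rewrite B_comb; set m := B u v + B v u; have := Bpos v0.
set c := B v v; set d := B u u => c0 H.
have {}H : 0 <= c * (4 * d * c - m ^+ 2) by move: H; congr (0 <= _); ring.
by rewrite pmulr_rge0 // subr_ge0 in H.
Qed.

Lemma sqrt_form_convex (a b : R) u v : 0 <= a -> 0 <= b ->
  Num.sqrt (B (a *: u + b *: v) (a *: u + b *: v))
    <= a * Num.sqrt (B u u) + b * Num.sqrt (B v v).
Proof.
move=> a0 b0; set p := Num.sqrt (B u u); set q := Num.sqrt (B v v).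
have p0 : 0 <= p := sqrtr_ge0 _.
have q0 : 0 <= q := sqrtr_ge0 _.
have pE : B u u = p ^+ 2 by rewrite sqr_sqrtr.
have qE : B v v = q ^+ 2 by rewrite sqr_sqrtr.
have r0 : 0 <= a * p + b * q by rewrite addr_ge0 // mulr_ge0.
(* After squaring, the two sides differ only in their cross terms, which Cauchy-Schwarz compares. *)
rewrite -(ler_pXn2r (n := 2)) ?nnegrE ?sqrtr_ge0 // sqr_sqrtr // B_comb pE qE.
have mpq : B u v + B v u <= 2 * p * q.
  have := form_cauchy_schwarz u v; rewrite pE qE.
  have -> : 4 * p ^+ 2 * q ^+ 2 = (2 * p * q) ^+ 2 by ring.
  have pq0 : 0 <= 2 * p * q by rewrite !mulr_ge0.
  move=> mpq2; rewrite (le_trans (ler_norm _)) // -(ger0_norm pq0).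
  by rewrite -!sqrtr_sqr ler_wsqrtr.
have := ler_wpM2l (mulr_ge0 a0 b0) mpq; lra.
Qed.

End Forms.

(** * Blow-up for the Riccati inequality *)

Lemma riccati_lt1 (R : realType) (w dw : R -> R) :
  (forall t : R, t \in `[0, 1] -> is_derive t 1 w (dw t)) ->
  (forall t : R, t \in `[0, 1] -> w t ^+ 2 <= dw t) ->
  w 0 < 1.
Proof.
move=> wd wle; rewrite ltNge; apply/negP => w0.
have wc : {within `[0, 1], continuous w}.
  by apply: derivable_within_continuous => t /wd [].
have oc (t : R) : t \in `]0, 1[ -> t \in `[0, 1].
  exact: subset_itv_oo_cc.
(* The derivative dominates a square, so [w] is nondecreasing; staying above 1, it has a
   differentiable inverse on the whole segment. *)
have w1 (t : R) : t \in `[0, 1] -> 1 <= w t.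
  move=> t01; apply: (le_trans w0).
  apply: (ger0_derive1_le_cc _ _ wc) => //.
  - by move=> z /oc/wd[].
  - move=> z /oc z01; rewrite derive1E (@derive_val _ _ _ _ _ _ _ (wd _ z01)).
    by rewrite (le_trans _ (wle _ z01)) ?sqr_ge0.
  - by rewrite in_itv /= lexx ler01.
  - by move: t01; rewrite in_itv /= => /andP[].
have wn (t : R) : t \in `[0, 1] -> w t != 0.
  by move=> /w1 wt; rewrite gt_eqF // (lt_le_trans ltr01).
(* [1 / w + t] decreases, which bounds the blow-up time of [w] by [1]. *)
pose v (t : R) := (w t)^-1 + t.
have vd (t : R) : t \in `[0, 1] -> is_derive t 1 v (- w t ^- 2 *: dw t + 1).
  by move=> t01; apply: is_deriveD; exact: (is_deriveV (wn _ t01) (wd _ t01)).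
have vc : {within `[0, 1], continuous v}.
  by apply: derivable_within_continuous => t /vd [].
have : v 1 <= v 0.
  apply: (ler0_derive1_le_cc _ _ vc) => //.
  - by move=> z /oc/vd[].
  - move=> z /oc z01; rewrite derive1E (@derive_val _ _ _ _ _ _ _ (vd _ z01)).
    rewrite /GRing.scale /= mulNr addrC subr_le0 mulrC ler_pdivlMr ?mul1r ?wle //.
    by rewrite exprn_gt0 // (lt_le_trans ltr01) ?w1.
  - by rewrite in_itv /= lexx ler01.
  - by rewrite in_itv /= lexx ler01.
(* The contradiction: [v 1] exceeds 1 strictly, while [v 0] is at most 1. *)
have i1 : (0 : R) < (w 1)^-1.
  by rewrite invr_gt0 (lt_le_trans ltr01) // w1 // in_itv /= lexx ler01.
have i0 : (w 0)^-1 <= 1 by rewrite invf_le1 // (lt_le_trans ltr01).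
rewrite /v; lra.
Qed.

(** * Derivatives of [f] as multilinear forms and along lines *)

Lemma is_derive_line (R : realType) (V : normedModType R) (F : V -> R)
    (x h : V) (t : R) :
  derivable F (x + t *: h) h ->
  is_derive t 1 (fun u : R => F (x + u *: h)) ('D_h F (x + t *: h)).
Proof.
(* The difference quotients of the restriction at [t] and of [F] in direction [h] are the same
   function of the increment. *)
have E : (fun e : R => e^-1 *: (((fun u : R => F (x + u *: h)) \o shift t)
             (e *: 1) - F (x + t *: h))) =
         (fun e => e^-1 *: ((F \o shift (x + t *: h)) (e *: h)
             - F (x + t *: h))).
  apply/funext => e /=; congr (_ *: (F _ - _)).
  by rewrite [e *: 1]mulr1 scalerDl addrCA.
by move=> dF; split; rewrite /derivable /derive E.
Qed.

Section Derivatives.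
Variables (R : realType) (n : nat) (U : set 'rV[R]_n) (f : 'rV[R]_n -> R).
Hypotheses (oU : open U) (fC : Ck_on 3 U f).

Let df x : U x -> differentiable f x.
Proof. by case: fC => + _; exact. Qed.

Let d2f h x : U x -> differentiable ('D_h f) x.
Proof. by case: fC => _ /(_ h)[+ _]; exact. Qed.

Let d3f h k x : U x -> differentiable ('D_k ('D_h f)) x.
Proof. by case: fC => _ /(_ h)[_ /(_ k)[+ _]]; exact. Qed.

Lemma D1_scalar x : U x -> scalar (D1 f x).
Proof.
by move=> /df dfx a u v; rewrite /D1 !deriveE // linearP.
Qed.

Lemma D2_scalarr x h : U x -> scalar (D2 f x h).
Proof.
by move=> /(d2f h) dfx a u v; rewrite /D2 !deriveE // linearP.
Qed.

Lemma D2_scalarl x k : U x -> scalar ((D2 f x)^~ k).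
Proof.
move=> Ux a u v; rewrite /D2.
(* Linearity of the first derivative holds throughout the open set [U], hence near [x], and may be
   differentiated. *)
have -> : 'D_k ('D_(a *: u + v) f) x = 'D_k (a \*: 'D_u f + 'D_v f) x.
  apply: near_eq_derive; near=> y.
  have Uy : U y by near: y; exact: open_nbhs_nbhs.
  by have := D1_scalar Uy a u v.
have du := diff_derivable (v := k) (d2f u Ux).
have dv := diff_derivable (v := k) (d2f v Ux).
by rewrite (deriveD (derivableZ du) dv) (deriveZ a du).
Unshelve. all: by end_near. Qed.

Lemma Gform_scalarl x k : U x -> scalar ((Gform f x)^~ k).
Proof.
move=> Ux a u v; rewrite /Gform; have /= -> := D2_scalarl k Ux a u v.
by rewrite (D1_scalar Ux) mulrDl -mulrA opprD addrACA -mulrBr.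
Qed.

Lemma Gform_scalarr x h : U x -> scalar (Gform f x h).
Proof.
move=> Ux a u v; rewrite /Gform (D2_scalarr h Ux) (D1_scalar Ux).
by rewrite mulrDr mulrCA opprD addrACA -mulrBr.
Qed.

Lemma is_derive_D1_line x h t : U (x + t *: h) ->
  is_derive t 1 (fun u : R => D1 f (x + u *: h) h) (D2 f (x + t *: h) h h).
Proof. by move=> Ux; apply: is_derive_line; exact/diff_derivable/d2f. Qed.

Lemma is_derive_D2_line x h t : U (x + t *: h) ->
  is_derive t 1 (fun u : R => D2 f (x + u *: h) h h) (D3 f (x + t *: h) h h h).
Proof. by move=> Ux; apply: is_derive_line; exact/diff_derivable/d3f. Qed.

(** Positivity keeps the square root away from its singularity at 0; the last factor is the
    derivative of [D2 - D1 ^+ 2] along the line. *)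
Lemma is_derive_sqrt_Gform_line x h t : U (x + t *: h) ->
  0 < Gform f (x + t *: h) h h ->
  is_derive t 1 (fun u : R => Num.sqrt (Gform f (x + u *: h) h h))
    ((2 * Num.sqrt (Gform f (x + t *: h) h h))^-1 *
     (D3 f (x + t *: h) h h h
      - 2 * D1 f (x + t *: h) h * D2 f (x + t *: h) h h)).
Proof.
move=> Ux G0; apply: is_derive1_comp; first exact: is_derive1_sqrt.
have d1 := is_derive_D1_line Ux.
have d2 := is_derive_D2_line Ux.
apply: (is_derive_eq (is_deriveB d2 (is_deriveM d1 d1))).
move: (D1 _ _ _) (D2 _ _ _ _) (D3 _ _ _ _ _) => p q r.
by rewrite /GRing.scale /=; ring.
Qed.

End Derivatives.

(** * From the concordance bound to the Riccati inequality *)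

Lemma powR_3half (R : realType) (g : R) : 0 <= g ->
  g `^ (3 / 2) = Num.sqrt g ^+ 3.
Proof.
by move=> g0; rewrite mulrC powRrM powR12_sqrt // -powR_mulrn ?sqrtr_ge0.
Qed.

(* Here [q], [r] stand for [f''[h,h]], [f'''[h,h,h]] and [c] for
   [1 / sqrt (nu - 1)], so that [c^-1 - c] is the barrier parameter. *)
Lemma concordance_riccati (R : realType) (p q r s c : R) :
  0 < c -> 0 < s -> s ^+ 2 = q - p ^+ 2 ->
  `|r - 6 * q * p + 4 * p ^+ 3| <= 2 * (c^-1 - c) * s ^+ 3 ->
  (p + c * s) ^+ 2 <= q + c * ((2 * s)^-1 * (r - 2 * p * q)).
Proof.
move=> c0 s0 sE; have -> : q = s ^+ 2 + p ^+ 2 by rewrite sE subrK.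
(* Only the lower bound on [r] matters; multiplied by [c / (2 * s)], it becomes exactly the
   claim. *)
move=> /ler_normlP[H _].
have cn : c != 0 by rewrite gt_eqF.
have sn : s != 0 by rewrite gt_eqF.
have k0 : 0 < c * (2 * s)^-1 by rewrite mulr_gt0 // invr_gt0 mulr_gt0.
have := ler_wpM2l (ltW k0) H.
rewrite -subr_ge0 => {}H; rewrite -subr_ge0; move: H; congr (0 <= _).
by field; rewrite cn sn.
Qed.

Lemma comb_lt1 (R : realType) (a c d e p q z : R) :
  0 <= a -> 0 <= 1 - a -> c * z <= c * (a * p + (1 - a) * q) ->
  d + c * p < 1 -> e + c * q < 1 -> a * d + (1 - a) * e + c * z < 1.
Proof.
(* Strictness must come from a positive weight: that of [Hq] if [a = 0], that of [Hp] otherwise. *)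
move=> a0 b0 zle Hp Hq; have [a00|an] := eqVneq a 0.
  by move: zle; rewrite a00; lra.
have ap : 0 < a by rewrite lt_neqAle eq_sym an.
have := mulr_gt0 ap (etrans (subr_gt0 _ _) Hp).
have := mulr_ge0 b0 (etrans (subr_ge0 _ _) (ltW Hq)).
lra.
Qed.

(** * Convexity of the set and inclusion of the interior *)

Theorem lemma3p6 (R : realType) (n : nat) (X : set 'rV[R]_n) (nu : R)
    (f : 'rV[R]_n -> R) (x0 : 'rV[R]_n) :
  regular_convex_set X ->
  2 <= nu ->
  proj_self_concordant_barrier X ((nu - 2) / Num.sqrt (nu - 1)) f ->
  X° x0 ->
  convex_set (Gamma_p nu f x0) /\ X° `<=` Gamma_p nu f x0.
Proof.
move=> [_ cX _ _] nu2 [_ fC Gpos _ conc] Xx0.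
have oX : open X° := open_interior X.
have nu1 : 0 < nu - 1 by lra.
pose c := (Num.sqrt (nu - 1))^-1.
have c0 : 0 < c by rewrite invr_gt0 sqrtr_gt0.
have cE : Num.sqrt (1 / (nu - 1)) = c by rewrite div1r sqrtrV // ltW.
have gE : (nu - 2) / Num.sqrt (nu - 1) = c^-1 - c.
  have sn : Num.sqrt (nu - 1) != 0 by rewrite gt_eqF // sqrtr_gt0.
  have -> : nu - 2 = Num.sqrt (nu - 1) ^+ 2 - 1 by rewrite sqr_sqrtr ?ltW //; ring.
  by rewrite invrK /c; field.
have GammaE y : Gamma_p nu f x0 y =
    (D1 f x0 (y - x0) + c * Num.sqrt (Gform f x0 (y - x0) (y - x0)) < 1).
  rewrite addrC -ltrBrDr -cE -sqrtrM //.
  by rewrite div1r invr_ge0 ltW.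
split.
  apply/convex_setP => x y a a0 a1; rewrite !GammaE => Hx Hy.
  have -> : a *: x + (1 - a) *: y - x0 = a *: (x - x0) + (1 - a) *: (y - x0).
    by rewrite !scalerBr addrACA -opprD -scalerDl subrKC scale1r.
  have b0 : 0 <= 1 - a by rewrite subr_ge0.
  have := sqrt_form_convex (fun k => Gform_scalarl oX fC k Xx0)
    (fun h => Gform_scalarr fC h Xx0) (Gpos _ Xx0)
    (x - x0) (y - x0) a0 b0.
  move=> /(ler_wpM2l (ltW c0)); rewrite (scalar_comb (D1_scalar fC Xx0)).
  by move=> Hz; exact: comb_lt1 a0 b0 Hz Hx Hy.
move=> x Xx; rewrite GammaE.
set h := x - x0.
have seg (t : R) : t \in `[0, 1] -> X° (x0 + t *: h).
  rewrite in_itv /= => /andP[t0 t1].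
  have := (convex_setP _).1 (convex_interior cX) _ _ _ t0 t1 Xx Xx0.
  by rewrite /h scalerBl scale1r scalerBr addrCA.
(* For [h = 0] the form vanishes and its root cannot be differentiated by the positive case; the
   inequality is then just [0 < 1]. *)
have [h0|hn] := eqVneq h 0.
  rewrite h0 /Gform.
  rewrite (scalar0 (D1_scalar fC Xx0)) (scalar0 (D2_scalarr fC 0 Xx0)).
  by rewrite mul0r subrr sqrtr0 mulr0 addr0 ltr01.
have Gt (t : R) : t \in `[0, 1] -> 0 < Gform f (x0 + t *: h) h h.
  by move=> /seg Xt; exact: Gpos.
pose w (t : R) := D1 f (x0 + t *: h) h + c * Num.sqrt (Gform f (x0 + t *: h) h h).
have -> : D1 f x0 h + c * Num.sqrt (Gform f x0 h h) = w 0.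
  by rewrite /w scale0r addr0.
apply: (riccati_lt1 (dw := fun t => D2 f (x0 + t *: h) h h +
   c *: ((2 * Num.sqrt (Gform f (x0 + t *: h) h h))^-1 *
     (D3 f (x0 + t *: h) h h h
      - 2 * D1 f (x0 + t *: h) h * D2 f (x0 + t *: h) h h)))) => t t01.
  have Xt := seg _ t01.
  have d1 := is_derive_D1_line fC Xt.
  have d2 := is_derive_sqrt_Gform_line fC Xt (Gt _ t01).
  exact: (is_deriveD d1 (is_deriveZ c d2)).
have G0 := Gt _ t01.
have GE : Gform f (x0 + t *: h) h h =
  D2 f (x0 + t *: h) h h - D1 f (x0 + t *: h) h ^+ 2 by rewrite expr2.
apply: concordance_riccati => //.
- by rewrite sqrtr_gt0.
- by rewrite sqr_sqrtr // ltW.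
- by rewrite -gE -(powR_3half (ltW G0)) GE; exact: conc (seg _ t01).
Qed.
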